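(* Let $\Theta$ be a variety and $H\in\Theta$. The category $LK_\Theta(H)$ of all LG-definable sets coincides with the category $L_0K_\Theta(H)$ of all MT-definable sets.
   Context: Setting: variety $\Theta$, infinite variable set $X^0$, $\Gamma^0$ its finite subsets, $W(X)$ free $\Theta$-algebras, points $\mu:W(X)\to H$. $\Phi(X)$ ($X\in\Gamma^0$) is the $X$-sort of the multi-sorted algebra of first-order formulas over $\Theta$ (free multi-sorted Halmos algebra generated by equalities in $W(X)$) with valuation $Val^X_H$; $LKer(\mu)=\{u\in\Phi(X):\mu\in Val^X_H(u)\}$. A set $A\subset\mathrm{Hom}(W(X),H)$ is LG-definable if $A=\{\mu\mid T\subset LKer(\mu)\}$ for some $T\subset\Phi(X)$; it is MT-definable if $A=\{\mu\mid T\subset Tp^H(\mu)\}$ for some $X$-type $T$, where an $X$-type is a set of first-order formulas over $X^0$ with free variables in $X=\{x_1,\dots,x_n\}$ and bound variables in $X^0\setminus X$ consistent with the theory of $H$, and $Tp^H(\mu)$ is the set of such formulas $u(x_1,\dots,x_n;\bar y)$ with $u(\mu(x_1),\dots,\mu(x_n);\bar y)$ true in $H$. $Set_\Theta(H)$ is the category whose objects are pairs $(X,A)$, $X\in\Gamma^0$, $A\subset\mathrm{Hom}(W(X),H)$, and whose morphisms $(X,A)\to(Y,B)$ are induced by homomorphisms $s:W(Y)\to W(X)$ with $\mu s\in B$ for all $\mu\in A$. $LK_\Theta(H)$ (resp. $L_0K_\Theta(H)$) is the full subcategory on objects with $A$ LG-definable (resp. MT-definable). *)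

(* Defs.v *)
From HB Require Import structures.
From mathcomp Require Import all_boot.
From mathcomp Require Import finmap.

Set Implicit Arguments.
Unset Strict Implicit.
Unset Printing Implicit Defensive.

Local Open Scope fset_scope.

Inductive term (ops : Type) (ar : ops -> nat) (T : Type) : Type :=
| Var (x : T)
| App (o : ops) (f : 'I_(ar o) -> term ar T).

Arguments Var {ops ar T} x.
Arguments App {ops ar T} o f.

Record algebra (ops : Type) (ar : ops -> nat) := Algebra {
  carrier :> Type;
  interp : forall o : ops, ('I_(ar o) -> carrier) -> carrier
}.

Fixpoint eval (ops : Type) (ar : ops -> nat) (H : algebra ar) (T : Type)
  (e : T -> H) (t : term ar T) : H :=
  match t with
  | Var x => e x
  | App o f => @interp _ ar H o (fun i => eval e (f i))
  end.

Fixpoint subst (ops : Type) (ar : ops -> nat) (T U : Type)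
  (sigma : T -> term ar U) (t : term ar T) : term ar U :=
  match t with
  | Var x => sigma x
  | App o f => App o (fun i => subst sigma (f i))
  end.

(* The variety Theta, given by a set of identities Sigma (in variables *)
(* nat).  [theq Sigma] is the fully invariant congruence generated by   *)
(* Sigma (equational consequence); W(T) = term T / theq Sigma is the    *)
(* free Theta-algebra on T.                                             *)

Inductive theq (ops : Type) (ar : ops -> nat)
  (Sigma : term ar nat -> term ar nat -> Prop) (T : Type)
  : term ar T -> term ar T -> Prop :=
| theq_ax (l r : term ar nat) (sigma : nat -> term ar T) :
    Sigma l r -> theq Sigma (subst sigma l) (subst sigma r)
| theq_refl t : theq Sigma t t
| theq_sym t t' : theq Sigma t t' -> theq Sigma t' t
| theq_trans t1 t2 t3 : theq Sigma t1 t2 -> theq Sigma t2 t3 -> theq Sigma t1 t3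
| theq_cong (o : ops) (f g : 'I_(ar o) -> term ar T) :
    (forall i, theq Sigma (f i) (g i)) -> theq Sigma (App o f) (App o g).

Definition in_variety (ops : Type) (ar : ops -> nat)
  (Sigma : term ar nat -> term ar nat -> Prop) (H : algebra ar) : Prop :=
  forall l r, Sigma l r -> forall e : nat -> H, eval e l = eval e r.

(* mu : W(T) -> H is a homomorphism (mu is given on representatives). *)
Definition is_hom (ops : Type) (ar : ops -> nat)
  (Sigma : term ar nat -> term ar nat -> Prop) (H : algebra ar) (T : Type)
  (mu : term ar T -> H) : Prop :=
  (forall t t', theq Sigma t t' -> mu t = mu t') /\
  (forall o (f : 'I_(ar o) -> term ar T), mu (App o f) = @interp _ ar H o (fun i => mu (f i))).
Arguments is_hom {ops ar} Sigma H {T} mu.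

(* s : W(T) -> W(U) is a homomorphism of free Theta-algebras. *)
Definition is_shom (ops : Type) (ar : ops -> nat)
  (Sigma : term ar nat -> term ar nat -> Prop) (T U : Type)
  (s : term ar T -> term ar U) : Prop :=
  (forall t t', theq Sigma t t' -> theq Sigma (s t) (s t')) /\
  (forall o (f : 'I_(ar o) -> term ar T),
      theq Sigma (s (App o f)) (App o (fun i => s (f i)))).

(* Variables: X^0 is the type V; X in Gamma^0 is a finite set X : {fset V}. *)
Definition fvar (V : choiceType) (X : {fset V}) : Type := {v : V | v \in X}.

(* The multi-sorted algebra Phi of formulas (Halmos algebra), given     *)
(* by its generators and operations; its sorts are X : {fset V}.        *)

Inductive hformula (V : choiceType) (ops : Type) (ar : ops -> nat)
  (Sigma : term ar nat -> term ar nat -> Prop) : {fset V} -> Type :=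
| HEq (X : {fset V}) (w w' : term ar (fvar X)) : hformula Sigma X
| HTrue (X : {fset V}) : hformula Sigma X
| HFalse (X : {fset V}) : hformula Sigma X
| HNeg (X : {fset V}) : hformula Sigma X -> hformula Sigma X
| HAnd (X : {fset V}) : hformula Sigma X -> hformula Sigma X -> hformula Sigma X
| HOr (X : {fset V}) : hformula Sigma X -> hformula Sigma X -> hformula Sigma X
| HEx (X : {fset V}) (x : V) : x \in X -> hformula Sigma X -> hformula Sigma X
| HSub (X Y : {fset V}) (s : term ar (fvar Y) -> term ar (fvar X)) :
    is_shom Sigma s -> hformula Sigma Y -> hformula Sigma X.

Fixpoint Val (V : choiceType) (ops : Type) (ar : ops -> nat)
  (Sigma : term ar nat -> term ar nat -> Prop) (H : algebra ar)
  (X : {fset V}) (u : hformula Sigma X) : (term ar (fvar X) -> H) -> Prop :=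
  match u in hformula _ X return (term ar (fvar X) -> H) -> Prop with
  | HEq _ w w' => fun mu => mu w = mu w'
  | HTrue _ => fun _ => True
  | HFalse _ => fun _ => False
  | HNeg _ u1 => fun mu => ~ @Val V ops ar Sigma H _ u1 mu
  | HAnd _ u1 u2 => fun mu => @Val V ops ar Sigma H _ u1 mu /\ @Val V ops ar Sigma H _ u2 mu
  | HOr _ u1 u2 => fun mu => @Val V ops ar Sigma H _ u1 mu \/ @Val V ops ar Sigma H _ u2 mu
  | HEx X0 x _ u1 => fun mu =>
      exists nu : term ar (fvar X0) -> H,
        @is_hom _ ar Sigma H _ nu /\
        (forall y : fvar X0, sval y <> x -> nu (Var y) = mu (Var y)) /\
        @Val V ops ar Sigma H _ u1 nu
  | HSub _ _ s _ u1 => fun mu => @Val V ops ar Sigma H _ u1 (fun t => mu (s t))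
  end.
Arguments Val {V ops ar Sigma} H {X} u mu.

Definition LKer (V : choiceType) (ops : Type) (ar : ops -> nat)
  (Sigma : term ar nat -> term ar nat -> Prop) (H : algebra ar)
  (X : {fset V}) (mu : term ar (fvar X) -> H) : hformula Sigma X -> Prop :=
  fun u => Val H u mu.
Arguments LKer {V ops ar Sigma} H {X} mu u.

Definition LG_definable (V : choiceType) (ops : Type) (ar : ops -> nat)
  (Sigma : term ar nat -> term ar nat -> Prop) (H : algebra ar)
  (X : {fset V}) (A : (term ar (fvar X) -> H) -> Prop) : Prop :=
  exists T : hformula Sigma X -> Prop,
    forall mu, A mu <-> (is_hom Sigma H mu /\ forall u, T u -> LKer H mu u).

Inductive fol (V : Type) (ops : Type) (ar : ops -> nat) : Type :=
| FEq (t t' : term ar V)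
| FBot
| FNot (p : fol V ar)
| FAnd (p q : fol V ar)
| FOr (p q : fol V ar)
| FImp (p q : fol V ar)
| FEx (v : V) (p : fol V ar)
| FAll (v : V) (p : fol V ar).

Fixpoint occurs (V : Type) (ops : Type) (ar : ops -> nat) (v : V)
  (t : term ar V) : Prop :=
  match t with
  | Var x => x = v
  | App o f => exists i, occurs v (f i)
  end.

Fixpoint free_in (V : Type) (ops : Type) (ar : ops -> nat) (v : V)
  (p : fol V ar) : Prop :=
  match p with
  | FEq t t' => occurs v t \/ occurs v t'
  | FBot => False
  | FNot p1 => free_in v p1
  | FAnd p1 p2 | FOr p1 p2 | FImp p1 p2 => free_in v p1 \/ free_in v p2
  | FEx w p1 | FAll w p1 => w <> v /\ free_in v p1
  end.

Fixpoint bound_in (V : Type) (ops : Type) (ar : ops -> nat) (v : V)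
  (p : fol V ar) : Prop :=
  match p with
  | FEq _ _ | FBot => False
  | FNot p1 => bound_in v p1
  | FAnd p1 p2 | FOr p1 p2 | FImp p1 p2 => bound_in v p1 \/ bound_in v p2
  | FEx w p1 | FAll w p1 => w = v \/ bound_in v p1
  end.

Fixpoint holds (V : eqType) (ops : Type) (ar : ops -> nat) (H : algebra ar)
  (e : V -> H) (p : fol V ar) : Prop :=
  match p with
  | FEq t t' => eval e t = eval e t'
  | FBot => False
  | FNot p1 => ~ holds e p1
  | FAnd p1 p2 => holds e p1 /\ holds e p2
  | FOr p1 p2 => holds e p1 \/ holds e p2
  | FImp p1 p2 => holds e p1 -> holds e p2
  | FEx w p1 => exists a : H, holds (fun z => if z == w then a else e z) p1
  | FAll w p1 => forall a : H, holds (fun z => if z == w then a else e z) p1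
  end.

Definition Xformula (V : choiceType) (ops : Type) (ar : ops -> nat)
  (X : {fset V}) (p : fol V ar) : Prop :=
  (forall v, free_in v p -> v \in X) /\ (forall v, bound_in v p -> v \notin X).

Definition Tp (V : choiceType) (ops : Type) (ar : ops -> nat) (H : algebra ar)
  (X : {fset V}) (mu : term ar (fvar X) -> H) (p : fol V ar) : Prop :=
  Xformula X p /\
  exists e : V -> H, (forall y : fvar X, e (sval y) = mu (Var y)) /\ holds e p.
Arguments Tp {V ops ar} H {X} mu p.

Definition MT_definable (V : choiceType) (ops : Type) (ar : ops -> nat)
  (Sigma : term ar nat -> term ar nat -> Prop) (H : algebra ar)
  (X : {fset V}) (A : (term ar (fvar X) -> H) -> Prop) : Prop :=
  exists T : fol V ar -> Prop,
    (forall p, T p -> Xformula X p) /\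
    forall mu, A mu <-> (is_hom Sigma H mu /\ forall p, T p -> Tp H mu p).

Arguments LG_definable {V ops ar} Sigma H {X} A.
Arguments MT_definable {V ops ar} Sigma H {X} A.

(* Main.v *)
(* Both kinds of definable sets are cut out by conjunctions of formulas, so
   it suffices that every Halmos formula of Phi(X) is equivalent at every point
   to a first-order X-formula, and conversely.  A Halmos formula is unfolded
   into first-order logic by naming the variables of the sort by terms, pushing
   each s_* into these terms, and turning "exists x" into a quantifier over a
   fresh variable of X^0 outside X -- this is where X^0 must be infinite.
   Conversely, an X-formula becomes a Halmos formula in a larger sort Y that
   contains its bound variables, pulled back to X along a substitution
   W(Y) -> W(X) fixing X.  When H or W(X) is empty there is at most one point,
   and every set of points is definable on both sides. *)

Require Import Defs.
From HB Require Import structures.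
From mathcomp Require Import all_boot finmap.
From Stdlib Require Import Classical FunctionalExtensionality.

Set Implicit Arguments.
Unset Strict Implicit.
Unset Printing Implicit Defensive.

Section Terms.
Variables (ops : Type) (ar : ops -> nat).

Lemma eval_ext (T : Type) (K : algebra ar) (e e' : T -> K) (t : term ar T) :
  (forall v, occurs v t -> e v = e' v) -> eval e t = eval e' t.
Proof.
elim: t => [x|o f IH] /= ee'; first exact: ee'.
congr interp; apply: functional_extensionality => i.
by apply: IH => v vfi; apply: ee'; exists i.
Qed.

Lemma eval_subst (T U : Type) (K : algebra ar) (e : U -> K) (s : T -> term ar U)
  (t : term ar T) : eval e (subst s t) = eval (fun y => eval e (s y)) t.
Proof.
elim: t => [x|o f IH] //=.
by congr interp; apply: functional_extensionality => i; exact: IH.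
Qed.

Lemma subst_comp (T U W : Type) (s : T -> term ar U) (s' : U -> term ar W)
  (t : term ar T) : subst s' (subst s t) = subst (fun y => subst s' (s y)) t.
Proof.
elim: t => [x|o f IH] //=.
by congr App; apply: functional_extensionality => i; exact: IH.
Qed.

Lemma occurs_subst (T U : Type) (s : T -> term ar U) (t : term ar T) v :
  occurs v (subst s t) -> exists y, occurs v (s y).
Proof.
elim: t => [x|o f IH] /=; first by exists x.
by case=> i /IH.
Qed.

Variable Sigma : term ar nat -> term ar nat -> Prop.

Lemma hom_evalE (K : algebra ar) (T : Type) (mu : term ar T -> K) :
  is_hom Sigma K mu -> forall t, mu t = eval (fun y => mu (Var y)) t.
Proof.
case=> _ muApp; elim=> [x|o f IH] //=.
by rewrite muApp; congr interp; apply: functional_extensionality => i; exact: IH.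
Qed.

Lemma eval_subst_homE (K : algebra ar) (T U : Type) (mu : term ar T -> K)
  (e : U -> K) (s : T -> term ar U) :
  is_hom Sigma K mu -> (forall y, eval e (s y) = mu (Var y)) ->
  forall t, eval e (subst s t) = mu t.
Proof.
move=> hom_mu se t; rewrite eval_subst (hom_evalE hom_mu).
by congr eval; apply: functional_extensionality.
Qed.

Lemma eval_is_hom (K : algebra ar) (T : Type) (a : T -> K) :
  in_variety Sigma K -> is_hom Sigma K (eval a).
Proof.
move=> KTheta; split=> // t t'; elim=> {t t'} //.
- by move=> l r sigma lr; rewrite !eval_subst; exact: KTheta.
- by move=> t1 t2 t3 _ -> _ ->.
- move=> o f g _ IH /=.
  by congr interp; apply: functional_extensionality => i; exact: IH.
Qed.

Lemma subst_is_shom (T U : Type) (s : T -> term ar U) : is_shom Sigma (subst s).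
Proof.
split=> [t t'|o f]; last exact: theq_refl.
elim=> {t t'}.
- by move=> l r sigma lr; rewrite !subst_comp; exact: theq_ax.
- by move=> t; exact: theq_refl.
- by move=> t t' _; exact: theq_sym.
- by move=> t1 t2 t3 _ h12 _; exact: theq_trans h12.
- by move=> o f g _; exact: theq_cong.
Qed.

Lemma hom_comp_shom (K : algebra ar) (T U : Type) (mu : term ar U -> K)
  (s : term ar T -> term ar U) :
  is_hom Sigma K mu -> is_shom Sigma s -> is_hom Sigma K (fun t => mu (s t)).
Proof.
case=> mu_theq muApp [s_theq sApp]; split=> [t t' tt'|o f].
  by apply: mu_theq; exact: s_theq.
by rewrite (mu_theq _ _ (sApp o f)) muApp.
Qed.

End Terms.

Lemma holds_ext (V : eqType) (ops : Type) (ar : ops -> nat) (K : algebra ar)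
  (p : fol V ar) (e e' : V -> K) :
  (forall v, free_in v p -> e v = e' v) -> (holds e p <-> holds e' p).
Proof.
elim: p e e' => [t t'||p IH|p IHp q IHq|p IHp q IHq|p IHp q IHq|w p IH|w p IH]
  e e' ee' /=.
- by rewrite (@eval_ext _ _ _ _ e e' t) ?(@eval_ext _ _ _ _ e e' t') // => v vt;
    apply: ee'; [right|left].
- by [].
- by rewrite (IH e e').
- by rewrite (IHp e e') ?(IHq e e') // => v vp; apply: ee'; [right|left].
- by rewrite (IHp e e') ?(IHq e e') // => v vp; apply: ee'; [right|left].
- by rewrite (IHp e e') ?(IHq e e') // => v vp; apply: ee'; [right|left].
- have IHa a : holds (fun z => if z == w then a else e z) p <->
               holds (fun z => if z == w then a else e' z) p.
    by apply: IH => v vp; case: eqP => // /nesym wv; apply: ee'.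
  by split=> -[a pa]; exists a; apply/IHa.
- have IHa a : holds (fun z => if z == w then a else e z) p <->
               holds (fun z => if z == w then a else e' z) p.
    by apply: IH => v vp; case: eqP => // /nesym wv; apply: ee'.
  by split=> pa a; apply/IHa.
Qed.

Section SortVariables.
Variables (V : choiceType) (X : {fset V}).

Definition fvar_ext (B : Type) (g : fvar X -> B) (b : B) (v : V) : B :=
  if insub v is Some y then g y else b.

Lemma fvar_ext_val (B : Type) (g : fvar X -> B) (b : B) (y : fvar X) :
  fvar_ext g b (sval y) = g y.
Proof. by rewrite /fvar_ext (valK y). Qed.

Lemma fvar_ext_in (B : Type) (g : fvar X -> B) (b : B) v (vX : v \in X) :
  fvar_ext g b v = g (exist _ v vX).
Proof. by rewrite /fvar_ext insubT. Qed.

Variables (ops : Type) (ar : ops -> nat) (K : algebra ar).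

Definition upd_hom (mu : term ar (fvar X) -> K) (x : V) (a : K) :
  term ar (fvar X) -> K :=
  eval (fun y => if sval y == x then a else mu (Var y)).

Lemma upd_hom_Var_eq mu x a (y : fvar X) : sval y = x -> upd_hom mu x a (Var y) = a.
Proof. by move=> yx; rewrite /upd_hom /= yx eqxx. Qed.

Lemma upd_hom_Var_neq mu x a (y : fvar X) :
  sval y <> x -> upd_hom mu x a (Var y) = mu (Var y).
Proof. by rewrite /upd_hom /=; case: eqP. Qed.

End SortVariables.

Section HformulaToFol.
Variables (V : choiceType) (ops : Type) (ar : ops -> nat)
  (Sigma : term ar nat -> term ar nat -> Prop) (fresh : seq V -> V).
Hypothesis freshP : forall A, fresh A \notin A.

Fixpoint fol_of_hformula (X : {fset V}) (u : hformula Sigma X) :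
    (fvar X -> term ar V) -> seq V -> fol V ar :=
  match u in hformula _ X return (fvar X -> term ar V) -> seq V -> fol V ar with
  | HEq _ w w' => fun s _ => FEq (subst s w) (subst s w')
  | HTrue _ => fun _ _ => FNot (@FBot V ops ar)
  | HFalse _ => fun _ _ => @FBot V ops ar
  | HNeg _ u1 => fun s A => FNot (fol_of_hformula u1 s A)
  | HAnd _ u1 u2 => fun s A => FAnd (fol_of_hformula u1 s A) (fol_of_hformula u2 s A)
  | HOr _ u1 u2 => fun s A => FOr (fol_of_hformula u1 s A) (fol_of_hformula u2 s A)
  | HEx _ x _ u1 => fun s A =>
      FEx (fresh A) (fol_of_hformula u1
        (fun y => if sval y == x then Var (fresh A) else s y) (fresh A :: A))
  | HSub _ _ s0 _ u1 => fun s A => fol_of_hformula u1 (fun y => subst s (s0 (Var y))) A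
  end.

Lemma free_in_fol_of_hformula (X : {fset V}) (u : hformula Sigma X) s A v :
  free_in v (fol_of_hformula u s A) -> exists y, occurs v (s y).
Proof.
elim: u s A => {X} [X w w'|X|X|X u IH|X u IHu u' IHu'|X u IHu u' IHu'
  |X x xX u IH|X Y s0 _ u IH] s A //=.
- by case=> vw; exact: occurs_subst vw.
- exact: IH.
- by case=> [/IHu|/IHu'].
- by case=> [/IHu|/IHu'].
- case=> vz /IH [y]; case: eqP => _ vy; last by exists y.
  by case: vz; rewrite vy.
- by case/IH=> y vy; exact: occurs_subst vy.
Qed.

Lemma bound_in_fol_of_hformula (X : {fset V}) (u : hformula Sigma X) s A v :
  bound_in v (fol_of_hformula u s A) -> v \notin A.
Proof.
elim: u s A => {X} [X w w'|X|X|X u IH|X u IHu u' IHu'|X u IHu u' IHu'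
  |X x xX u IH|X Y s0 _ u IH] s A //=.
- exact: IH.
- by case=> [/IHu|/IHu'].
- by case=> [/IHu|/IHu'].
- by case=> [<-|/IH]; [exact: freshP | rewrite in_cons negb_or => /andP[]].
- exact: IH.
Qed.

Variables (K : algebra ar) (KTheta : in_variety Sigma K).

(* [s] names the variables of the sort by terms over [A]; fresh variables are *)
(* drawn outside [A] so that they are not captured. *)
Lemma Val_fol_of_hformula (X : {fset V}) (u : hformula Sigma X) s A
  (mu : term ar (fvar X) -> K) (e : V -> K) :
  is_hom Sigma K mu ->
  (forall y v, occurs v (s y) -> v \in A) ->
  (forall y, eval e (s y) = mu (Var y)) ->
  (Val K u mu <-> holds e (fol_of_hformula u s A)).
Proof.
elim: u s A mu e => {X} [X w w'|X|X|X u IH|X u IHu u' IHu'|X u IHu u' IHu'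
  |X x xX u IH|X Y s0 s0_shom u IH] s A mu e hom_mu sA se /=.
- by rewrite !(eval_subst_homE hom_mu se).
- by split=> // _ /=.
- by [].
- by rewrite (IH s A mu e).
- by rewrite (IHu s A mu e) // (IHu' s A mu e).
- by rewrite (IHu s A mu e) // (IHu' s A mu e).
- set z := fresh A.
  set s' := fun y : fvar X => if sval y == x then Var z else s y.
  have s'A y v : occurs v (s' y) -> v \in z :: A.
    rewrite /s'; case: eqP => _ /=; first by move=> ->; rewrite mem_head.
    by move/sA; rewrite in_cons => ->; rewrite orbT.
  pose ex := exist (fun v => v \in X) x xX.
  have s'e (nu : term ar (fvar X) -> K) :
      (forall y, sval y <> x -> nu (Var y) = mu (Var y)) ->
      forall y, eval (fun w => if w == z then nu (Var ex) else e w) (s' y) = nu (Var y).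
    move=> nu_mu y; rewrite /s'; case: eqP => [yx|yx] /=.
      by rewrite eqxx; congr (nu (Var _)); apply: val_inj.
    rewrite (nu_mu y yx) -se; apply: eval_ext => v vy.
    by case: eqP => // vz; move: (freshP A); rewrite -/z -vz (sA _ _ vy).
  split=> [[nu [hom_nu [nu_mu Vnu]]] | [a Ha]].
    by exists (nu (Var ex)); apply/(IH s' (z :: A) nu) => //; exact: s'e.
  have upd_mu := @upd_hom_Var_neq _ _ _ _ K mu x a.
  exists (upd_hom mu x a); split; first exact: eval_is_hom.
  split=> //; apply/(IH s' (z :: A) _ _ (eval_is_hom _ KTheta) s'A (s'e _ upd_mu)).
  by rewrite upd_hom_Var_eq.
- apply: IH => [|y v|y]; first exact: hom_comp_shom.
    by move=> vy; have [y' /sA] := occurs_subst vy.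
  exact: (eval_subst_homE hom_mu se).
Qed.

End HformulaToFol.

Section SubsetSeq.
Variables (T : eqType) (pT : predType T) (A : pT).

Lemma subset_catP (s1 s2 : seq T) :
  {subset s1 ++ s2 <= A} -> {subset s1 <= A} /\ {subset s2 <= A}.
Proof. by move=> sA; split=> x xs; apply: sA; rewrite mem_cat xs ?orbT. Qed.

Lemma subset_consP x (s : seq T) :
  {subset x :: s <= A} -> x \in A /\ {subset s <= A}.
Proof. by move=> sA; split=> [|y ys]; apply: sA; rewrite in_cons ?eqxx ?ys ?orbT. Qed.

End SubsetSeq.

Section FolToHformula.
Variables (V : choiceType) (ops : Type) (ar : ops -> nat)
  (Sigma : term ar nat -> term ar nat -> Prop).

Fixpoint term_vars (t : term ar V) : seq V :=
  match t with
  | Var x => [:: x]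
  | App o f => flatten [seq term_vars (f i) | i <- enum 'I_(ar o)]
  end.

Fixpoint fol_vars (p : fol V ar) : seq V :=
  match p with
  | FEq t t' => term_vars t ++ term_vars t'
  | FBot => [::]
  | FNot p1 => fol_vars p1
  | FAnd p1 p2 | FOr p1 p2 | FImp p1 p2 => fol_vars p1 ++ fol_vars p2
  | FEx w p1 | FAll w p1 => w :: fol_vars p1
  end.

Lemma occurs_term_vars v t : occurs v t -> v \in term_vars t.
Proof.
elim: t => [x|o f IH] /=; first by move=> ->; rewrite mem_head.
by case=> i /IH vfi; apply/flatten_mapP; exists i; rewrite ?mem_enum.
Qed.

Lemma free_in_fol_vars v p : free_in v p -> v \in fol_vars p.
Proof.
elim: p => [t t'||p IH|p IHp q IHq|p IHp q IHq|p IHp q IHq|w p IH|w p IH] //=.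
- by case=> /occurs_term_vars vt; rewrite mem_cat vt ?orbT.
- by case=> [/IHp|/IHq] vp; rewrite mem_cat vp ?orbT.
- by case=> [/IHp|/IHq] vp; rewrite mem_cat vp ?orbT.
- by case=> [/IHp|/IHq] vp; rewrite mem_cat vp ?orbT.
- by case=> _ /IH vp; rewrite in_cons vp orbT.
- by case=> _ /IH vp; rewrite in_cons vp orbT.
Qed.

Lemma eq_in_holds (K : algebra ar) p (e e' : V -> K) :
  {in fol_vars p, e =1 e'} -> (holds e p <-> holds e' p).
Proof. by move=> ee'; apply: holds_ext => v /free_in_fol_vars /ee'. Qed.

(* [tr] must be a retraction of [V] onto the sort [Y]; off [Y] it is junk. *)
Variables (Y : {fset V}) (tr : V -> fvar Y).
Hypothesis trK : forall v, v \in Y -> sval (tr v) = v.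

Fixpoint hformula_of_fol (p : fol V ar) : hformula Sigma Y :=
  let conv := subst (fun v => Var (tr v)) in
  match p with
  | FEq t t' => HEq Sigma (conv t) (conv t')
  | FBot => HFalse Sigma Y
  | FNot p1 => HNeg (hformula_of_fol p1)
  | FAnd p1 p2 => HAnd (hformula_of_fol p1) (hformula_of_fol p2)
  | FOr p1 p2 => HOr (hformula_of_fol p1) (hformula_of_fol p2)
  | FImp p1 p2 => HOr (HNeg (hformula_of_fol p1)) (hformula_of_fol p2)
  | FEx w p1 => HEx (proj2_sig (tr w)) (hformula_of_fol p1)
  | FAll w p1 => HNeg (HEx (proj2_sig (tr w)) (HNeg (hformula_of_fol p1)))
  end.

Variables (K : algebra ar) (KTheta : in_variety Sigma K).

Lemma exists_hom_update (mu : term ar (fvar Y) -> K) w (Q : (V -> K) -> Prop) :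
  is_hom Sigma K mu -> w \in Y ->
  (forall e e', {in Y, e =1 e'} -> (Q e <-> Q e')) ->
  (exists nu, is_hom Sigma K nu /\
      (forall y, sval y <> sval (tr w) -> nu (Var y) = mu (Var y)) /\
      Q (fun v => nu (Var (tr v)))) <->
  exists a, Q (fun z => if z == w then a else mu (Var (tr z))).
Proof.
move=> hom_mu wY QY; rewrite (trK wY).
split=> [[nu [hom_nu [nu_mu Qnu]]] | [a Qa]].
  exists (nu (Var (tr w))); apply/(QY _ _ _)/Qnu => v vY.
  by case: eqP => [->|vw] //; rewrite nu_mu // trK.
exists (upd_hom mu w a); split; first exact: eval_is_hom.
split=> [y|]; first exact: upd_hom_Var_neq.
apply/(QY _ _ _)/Qa => v vY /=.
by rewrite /upd_hom /= (trK vY); case: eqP.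
Qed.

Lemma Val_hformula_of_fol p (mu : term ar (fvar Y) -> K) :
  is_hom Sigma K mu -> {subset fol_vars p <= Y} ->
  (Val K (hformula_of_fol p) mu <-> holds (fun v => mu (Var (tr v))) p).
Proof.
elim: p mu => [t t'||p IH|p IHp q IHq|p IHp q IHq|p IHp q IHq|w p IH|w p IH]
  mu hom_mu /=.
- by rewrite !(hom_evalE hom_mu) !eval_subst.
- by [].
- by move=> pY; rewrite (IH mu).
- by case/subset_catP=> pY qY; rewrite (IHp mu) ?(IHq mu).
- by case/subset_catP=> pY qY; rewrite (IHp mu) ?(IHq mu).
- case/subset_catP=> pY qY; rewrite (IHp mu) ?(IHq mu) //.
  split=> [[notp /notp []|qmu _ //]|pq].
  by case: (classic (holds (fun v => mu (Var (tr v))) p)) => [/pq|]; [right|left].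
- case/subset_consP=> wY pY.
  rewrite -(exists_hom_update (Q := fun e => holds e p) hom_mu wY); last first.
    by move=> e e' ee'; apply: eq_in_holds => v /pY /ee'.
  by split=> -[nu [hom_nu [nu_mu Vnu]]]; exists nu; split=> //; split=> //; apply/IH.
- case/subset_consP=> wY pY.
  have exists_not_p : (exists nu, is_hom Sigma K nu /\
      (forall y, sval y <> sval (tr w) -> nu (Var y) = mu (Var y)) /\
      ~ Val K (hformula_of_fol p) nu) <->
    exists a, ~ holds (fun z => if z == w then a else mu (Var (tr z))) p.
    rewrite -(exists_hom_update (Q := fun e => ~ holds e p) hom_mu wY); last first.
      by move=> e e' ee'; rewrite (eq_in_holds (e' := e')) // => v /pY /ee'.
    split=> -[nu [hom_nu [nu_mu notp]]]; exists nu; split=> //; split=> //.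
      by rewrite -(IH nu).
    by rewrite (IH nu).
  rewrite exists_not_p; split=> [/not_ex_not_all //|allp [a]].
  by apply.
Qed.

End FolToHformula.

Lemma eq_fun_of_empty (A B : Type) : (A -> False) -> forall f g : A -> B, f = g.
Proof. by move=> Aempty f g; apply: functional_extensionality => a; case: (Aempty a). Qed.

Section Expressibility.
Variables (V : choiceType) (ops : Type) (ar : ops -> nat)
  (Sigma : term ar nat -> term ar nat -> Prop)
  (K : algebra ar) (KTheta : in_variety Sigma K) (X : {fset V}).

Lemma Tp_holds (mu : term ar (fvar X) -> K) (e : V -> K) p :
  Xformula X p -> (forall y, e (sval y) = mu (Var y)) -> (Tp K mu p <-> holds e p).
Proof.
move=> pX emu; split=> [[_ [e' [e'mu pe']]] | pe]; last by split=> //; exists e.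
apply/(holds_ext (e' := e')) => // v /pX.1 vX.
by move: (emu (exist _ v vX)) (e'mu (exist _ v vX)) => /= -> ->.
Qed.

Lemma hformula_expressible_in_fol (fresh : seq V -> V) (h0 : K) :
  (forall A, fresh A \notin A) -> forall u : hformula Sigma X,
  exists p, Xformula X p /\ forall mu, is_hom Sigma K mu -> (Tp K mu p <-> Val K u mu).
Proof.
move=> freshP u; pose s0 (y : fvar X) := @Var ops ar V (sval y).
have s0X y v : occurs v (s0 y) -> v \in enum_fset X by move=> /= <-; exact: valP.
have pX : Xformula X (fol_of_hformula fresh u s0 (enum_fset X)).
  split=> v; first by case/free_in_fol_of_hformula=> y /s0X.
  exact: bound_in_fol_of_hformula.
exists (fol_of_hformula fresh u s0 (enum_fset X)); split=> // mu hom_mu.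
pose e := fvar_ext (fun y => mu (Var y)) h0.
have emu y : e (sval y) = mu (Var y) by rewrite /e fvar_ext_val.
by rewrite (Tp_holds pX emu) (Val_fol_of_hformula freshP KTheta u hom_mu s0X emu).
Qed.

Lemma Val_subsingleton (P : (term ar (fvar X) -> K) -> Prop) :
  (forall mu mu' : term ar (fvar X) -> K, mu = mu') ->
  exists u : hformula Sigma X, forall mu, is_hom Sigma K mu -> (Val K u mu <-> P mu).
Proof.
move=> mu_eq; case: (classic (exists mu, P mu)) => [[mu0 Pmu0]|noP].
  by exists (HTrue Sigma X) => mu _; rewrite (mu_eq mu mu0).
by exists (HFalse Sigma X) => mu _; split=> // Pmu; apply: noP; exists mu.
Qed.

(* [v0] only serves as a default value for the retraction onto [Y]. *)
Lemma fol_expressible_in_hformula (v0 : V) p :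
  Xformula X p ->
  exists u : hformula Sigma X, forall mu, is_hom Sigma K mu -> (Val K u mu <-> Tp K mu p).
Proof.
move=> pX; case: (classic (inhabited (term ar (fvar X)))) => [[t0]|noterm]; last first.
  apply: Val_subsingleton; apply: eq_fun_of_empty => t; exact: noterm (inhabits t).
pose Y := (X `|` seq_fset tt (v0 :: fol_vars p))%fset.
have v0Y : v0 \in Y by rewrite in_fsetU seq_fsetE mem_head orbT.
have XY : {subset X <= Y} by move=> v vX; rewrite in_fsetU vX.
have pY : {subset fol_vars p <= Y}.
  by move=> v vp; rewrite in_fsetU seq_fsetE in_cons vp !orbT.
pose tr := fvar_ext id (exist _ v0 v0Y : fvar Y).
have trK v : v \in Y -> sval (tr v) = v by move=> vY; rewrite /tr (fvar_ext_in _ _ vY).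
pose tau (y : fvar Y) := fvar_ext Var t0 (sval y).
exists (HSub (subst_is_shom Sigma tau) (hformula_of_fol Sigma tr p)) => mu hom_mu /=.
have hom_mu_tau := hom_comp_shom hom_mu (subst_is_shom Sigma tau).
have emu y : mu (tau (tr (sval y))) = mu (Var y).
  by rewrite /tau trK ?fvar_ext_val //; apply/XY/valP.
rewrite (Val_hformula_of_fol trK KTheta hom_mu_tau pY).
exact: iff_sym (Tp_holds pX emu).
Qed.

End Expressibility.

Section Transfer.
Variables (V : choiceType) (ops : Type) (ar : ops -> nat)
  (Sigma : term ar nat -> term ar nat -> Prop)
  (K : algebra ar) (X : {fset V}) (A : (term ar (fvar X) -> K) -> Prop).

Lemma MT_definable_of_LG :
  (forall u : hformula Sigma X, exists p, Xformula X p /\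
     forall mu, is_hom Sigma K mu -> (Tp K mu p <-> Val K u mu)) ->
  LG_definable Sigma K A -> MT_definable Sigma K A.
Proof.
move=> expr [T AT].
exists (fun p => Xformula X p /\ exists u, T u /\
  forall mu, is_hom Sigma K mu -> (Tp K mu p <-> Val K u mu)).
split=> [p [] //|mu]; rewrite AT.
split=> -[hom_mu Tmu]; split=> //.
  by move=> p [_ [u [Tu pu]]]; apply/pu => //; exact: Tmu.
move=> u Tu; have [p [pX pu]] := expr u.
by apply/(pu _ hom_mu)/Tmu; split=> //; exists u.
Qed.

Lemma LG_definable_of_MT :
  (forall p, Xformula X p -> exists u : hformula Sigma X,
     forall mu, is_hom Sigma K mu -> (Val K u mu <-> Tp K mu p)) ->
  MT_definable Sigma K A -> LG_definable Sigma K A.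
Proof.
move=> expr [T [TX AT]].
exists (fun u => exists p, T p /\
  forall mu, is_hom Sigma K mu -> (Val K u mu <-> Tp K mu p)).
move=> mu; rewrite AT.
split=> -[hom_mu Tmu]; split=> //.
  by move=> u [p [Tp up]]; apply/up => //; exact: Tmu.
move=> p Tp; have [u up] := expr p (TX p Tp).
by apply/(up _ hom_mu)/Tmu; exists p.
Qed.

Lemma MT_definable_subsingleton :
  (forall mu, A mu -> is_hom Sigma K mu) ->
  (forall mu mu' : term ar (fvar X) -> K, mu = mu') -> MT_definable Sigma K A.
Proof.
move=> A_hom mu_eq; case: (classic (exists mu, A mu)) => [[mu0 Amu0]|noA].
  exists (fun _ => False); split=> // mu.
  by split=> [/A_hom //|_]; rewrite (mu_eq mu mu0).
exists (eq (@FBot V ops ar)); split=> [_ <- //|mu].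
split=> [Amu|[_ /(_ _ erefl) [_ [e [_ []]]]]].
by case: noA; exists mu.
Qed.

End Transfer.

Theorem corollary3p15 (V : choiceType)
  (V_infinite : forall s : seq V, exists v : V, v \notin s)
  (ops : Type) (ar : ops -> nat)
  (Sigma : term ar nat -> term ar nat -> Prop)
  (H : algebra ar) (H_in_Theta : in_variety Sigma H) :
  forall (X : {fset V}) (A : (term ar (fvar X) -> H) -> Prop),
    LG_definable Sigma H A <-> MT_definable Sigma H A.
Proof.
move=> X A; pose fresh s := xchoose (V_infinite s).
have freshP s : fresh s \notin s := xchooseP (V_infinite s).
split.
- case: (classic (inhabited H)) => [[h0]|Hempty].
    exact/MT_definable_of_LG/(hformula_expressible_in_fol H_in_Theta h0 freshP).
  case=> T AT; apply: MT_definable_subsingleton => [mu /AT[] //|mu mu'].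
  by apply: eq_fun_of_empty => t; apply: Hempty; exact: inhabits (mu t).
- exact/LG_definable_of_MT/(fol_expressible_in_hformula H_in_Theta (fresh [::])).
Qed.
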